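(* Let the Motzkin numbers $M_n$ be defined by $M_0=M_1=1$ and $M_n=\frac{2n+1}{n+2}M_{n-1} +\frac{3n-3}{n+2}M_{n-2}$ for $n\geq 2$. The sequence $\{M_n\}_{n\geq 4}$ is ratio log-concave.
   Context: A sequence $(x_n)_{n\ge m}$ of positive reals is log-concave if $x_n^2\ge x_{n-1}x_{n+1}$ for all $n\ge m+1$. A sequence $(a_n)_{n\ge m}$ of positive reals is ratio log-concave if $(a_{n+1}/a_n)_{n\ge m}$ is log-concave. *)

(* Defs.v *)
From Stdlib Require Import Reals Lra Lia.
Open Scope R_scope.

Definition log_concave_from (m : nat) (x : nat -> R) : Prop :=
  (forall n : nat, (m <= n)%nat -> 0 < x n) /\
  (forall n : nat, (m + 1 <= n)%nat -> x n ^ 2 >= x (n - 1)%nat * x (n + 1)%nat).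

Definition ratio_log_concave_from (m : nat) (a : nat -> R) : Prop :=
  (forall n : nat, (m <= n)%nat -> 0 < a n) /\
  log_concave_from m (fun n => a (n + 1)%nat / a n).

Fixpoint motzkin (n : nat) : R :=
  match n with
  | 0%nat => 1
  | S p =>
      match p with
      | 0%nat => 1
      | S q =>
          (2 * INR n + 1) / (INR n + 2) * motzkin p +
          (3 * INR n - 3) / (INR n + 2) * motzkin q
      end
  end.

Lemma motzkin_0 : motzkin 0 = 1.
Proof. reflexivity. Qed.

Lemma motzkin_1 : motzkin 1 = 1.
Proof. reflexivity. Qed.

Lemma motzkin_rec (n : nat) : (2 <= n)%nat ->
  motzkin n = (2 * INR n + 1) / (INR n + 2) * motzkin (n - 1) +
              (3 * INR n - 3) / (INR n + 2) * motzkin (n - 2).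
Proof.
intros Hn; destruct n as [|[|q]]; try lia.
replace (S (S q) - 1)%nat with (S q) by lia.
replace (S (S q) - 2)%nat with q by lia.
reflexivity.
Qed.

(* Main.v *)
(** The ratios [r_n = M_(n+1) / M_n] satisfy [r_(n+1) = (2n+5)/(n+4) + (3n+3)/((n+4) r_n)].
    With [w = n + 2], the formal solution of this recurrence is
    [3 - 9/(2w) + 63/(16w^2) - 9/(2w^3) + O(w^-4)], and the map contracts errors by a factor
    close to [1/3] while reversing their sign.  Hence lowering and raising the coefficient of
    [w^-3] by suitable constants gives bounds [f(w) <= r_n <= g(w)] that propagate by
    induction.  They are sharp enough, since [f(w)^2 >= g(w-1) g(w+1)]. *)

Require Import Defs.
From Stdlib Require Import Reals Lra Lia.
Open Scope R_scope.

Definition motzkin_ratio (n : nat) : R := motzkin (n + 1) / motzkin n.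

(* The shifts [3/2] and [2] of the last coefficient [9/2] were found by search; they make
   all the inequalities below hold from [n = 4] on. *)
Definition ratio_lower (w : R) : R :=
  (48 * w ^ 3 - 72 * w ^ 2 + 63 * w - 96) / (16 * w ^ 3).

Definition ratio_upper (w : R) : R :=
  (48 * w ^ 3 - 72 * w ^ 2 + 63 * w - 40) / (16 * w ^ 3).

(** The recurrence for [motzkin (n + 2)] divided by [motzkin (n + 1)]: [w] is the index [n + 2] and
    [x] the ratio [motzkin_ratio n]. *)
Definition ratio_step (w x : R) : R :=
  (2 * w + 1) / (w + 2) + (3 * w - 3) / (w + 2) / x.

Lemma motzkin_pos (n : nat) : 0 < motzkin n.
Proof.
enough (H : 0 < motzkin n /\ 0 < motzkin (S n)) by tauto.
induction n as [|n [IH1 IH2]].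
- simpl; lra.
- split; [exact IH2|].
  rewrite motzkin_rec by lia.
  replace (S (S n) - 1)%nat with (S n) by lia.
  replace (S (S n) - 2)%nat with n by lia.
  rewrite !S_INR.
  pose proof (pos_INR n).
  apply Rplus_lt_0_compat; apply Rmult_lt_0_compat; trivial;
    apply Rdiv_lt_0_compat; lra.
Qed.

Lemma motzkin_ratio_pos (n : nat) : 0 < motzkin_ratio n.
Proof. apply Rdiv_lt_0_compat; apply motzkin_pos. Qed.

Lemma motzkin_ratio_succ (n : nat) :
  motzkin_ratio (S n) = ratio_step (INR n + 2) (motzkin_ratio n).
Proof.
unfold motzkin_ratio, ratio_step.
rewrite (motzkin_rec (S n + 1)) by lia.
replace (S n + 1 - 1)%nat with (S n) by lia.
replace (S n + 1 - 2)%nat with n by lia.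
replace (n + 1)%nat with (S n) by lia.
replace (INR (S n + 1)) with (INR n + 2)
  by (rewrite plus_INR, S_INR; simpl; ring).
pose proof (pos_INR n).
pose proof (motzkin_pos n).
pose proof (motzkin_pos (S n)).
field; lra.
Qed.

Lemma ratio_step_decr (w x y : R) :
  1 <= w -> 0 < x -> x <= y -> ratio_step w y <= ratio_step w x.
Proof.
intros Hw Hx Hxy.
unfold ratio_step, Rdiv at 2 5.
apply Rplus_le_compat_l, Rmult_le_compat_l.
- apply Rmult_le_pos; [lra|].
  left; apply Rinv_0_lt_compat; lra.
- apply Rinv_le_contravar; lra.
Qed.

Lemma ratio_lower_num_pos (w : R) :
  6 <= w -> 0 < 48 * w ^ 3 - 72 * w ^ 2 + 63 * w - 96.
Proof. intros Hw; nra. Qed.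

Lemma ratio_lower_pos (w : R) : 6 <= w -> 0 < ratio_lower w.
Proof.
intros Hw; apply Rdiv_lt_0_compat; [now apply ratio_lower_num_pos|].
apply Rmult_lt_0_compat; [lra|apply pow_lt; lra].
Qed.

(** Certificate form for comparing rational functions: [field] checks the difference, and only the
    signs of [p] and [q] remain. *)
Lemma Rle_of_Rminus_frac (x y p q : R) :
  0 <= p -> 0 < q -> y - x = p / q -> x <= y.
Proof.
intros Hp Hq E.
assert (0 <= p / q) by (apply Rmult_le_pos; [|left; apply Rinv_0_lt_compat]; assumption).
lra.
Qed.

Ltac nonneg_coefs :=
  repeat first [lra | apply Rplus_le_le_0_compat | apply Rmult_le_pos | apply pow_le].

Lemma ratio_step_lower (w : R) :
  6 <= w -> ratio_step w (ratio_lower w) <= ratio_upper (w + 1).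
Proof.
intros Hw.
pose proof (ratio_lower_num_pos w Hw) as Hp.
(* Recentred at the smallest admissible [w], the numerator of the difference has only positive
   coefficients, so its sign is read off term by term. *)
set (t := w - 6).
assert (Ht : 0 <= t) by (unfold t; lra).
apply (Rle_of_Rminus_frac _ _
  (1152 * t ^ 4 + 22905 * t ^ 3 + 161541 * t ^ 2 + 454626 * t + 368496)
  (16 * (w + 1) ^ 3 * (w + 2) * (48 * w ^ 3 - 72 * w ^ 2 + 63 * w - 96))).
- nonneg_coefs.
- repeat apply Rmult_lt_0_compat; trivial; try apply pow_lt; lra.
- unfold ratio_step, ratio_lower, ratio_upper, t; field; lra.
Qed.

Lemma ratio_step_upper (w : R) :
  6 <= w -> ratio_lower (w + 1) <= ratio_step w (ratio_upper w).
Proof.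
intros Hw.
(* The numerator of [ratio_upper] is larger by 56, so it is positive too. *)
pose proof (ratio_lower_num_pos w Hw) as Hp.
set (t := w - 6).
assert (Ht : 0 <= t) by (unfold t; lra).
apply (Rle_of_Rminus_frac _ _
  (640 * t ^ 4 + 18311 * t ^ 3 + 185211 * t ^ 2 + 805654 * t + 1286864)
  (16 * (w + 1) ^ 3 * (w + 2) * (48 * w ^ 3 - 72 * w ^ 2 + 63 * w - 40))).
- nonneg_coefs.
- repeat apply Rmult_lt_0_compat; trivial; try apply pow_lt; lra.
- unfold ratio_step, ratio_lower, ratio_upper, t; field; lra.
Qed.

(** The threshold 7 is [n + 2] at [n = 5], the first index where log-concavity is required; it keeps
    [w - 1] in the range of the bounds. *)
Lemma ratio_bounds_log_concave (w : R) :
  7 <= w -> ratio_upper (w - 1) * ratio_upper (w + 1) <= ratio_lower w ^ 2.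
Proof.
intros Hw.
set (t := w - 7).
assert (Ht : 0 <= t) by (unfold t; lra).
apply (Rle_of_Rminus_frac _ _
  (1536 * t ^ 9 + 81504 * t ^ 8 + 1891152 * t ^ 7 + 25085198 * t ^ 6 +
   208420140 * t ^ 5 + 1114760901 * t ^ 4 + 3780286780 * t ^ 3 +
   7610865555 * t ^ 2 + 7698474210 * t + 2296964960)
  (256 * w ^ 6 * (w - 1) ^ 3 * (w + 1) ^ 3)).
- nonneg_coefs.
- repeat apply Rmult_lt_0_compat; try apply pow_lt; lra.
- unfold ratio_lower, ratio_upper, t; field; lra.
Qed.

Lemma motzkin_ratio_bounds (n : nat) :
  (4 <= n)%nat ->
  ratio_lower (INR n + 2) <= motzkin_ratio n <= ratio_upper (INR n + 2).
Proof.
intros Hn; induction Hn as [|n Hn [IHl IHu]].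
(* At [n = 4] the ratio is 21/9, between 8058/3456 and 8114/3456. *)
- unfold motzkin_ratio, ratio_lower, ratio_upper; simpl; lra.
- assert (Hw : 6 <= INR n + 2) by (apply le_INR in Hn; simpl in Hn; lra).
  rewrite motzkin_ratio_succ, S_INR.
  replace (INR n + 1 + 2) with (INR n + 2 + 1) by ring.
  split.
  (* The step is decreasing in the ratio, so the new lower bound comes from the old upper bound, and
     vice versa. *)
  + eapply Rle_trans; [apply ratio_step_upper, Hw|].
    apply ratio_step_decr; trivial; [lra|apply motzkin_ratio_pos].
  + eapply Rle_trans; [|apply ratio_step_lower, Hw].
    apply ratio_step_decr; trivial; [lra|apply ratio_lower_pos, Hw].
Qed.

Theorem theorem4p3 : ratio_log_concave_from 4 motzkin.
Proof.
split; [intros n _; apply motzkin_pos|].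
split; [intros n _; apply motzkin_ratio_pos|].
intros [|n] Hn; [lia|].
change (motzkin_ratio (S n) ^ 2 >=
        motzkin_ratio (S n - 1) * motzkin_ratio (S n + 1)).
replace (S n - 1)%nat with n by lia.
replace (S n + 1)%nat with (S (S n)) by lia.
assert (Hw : 7 <= INR (S n) + 2) by (apply le_INR in Hn; simpl in Hn |- *; lra).
destruct (motzkin_ratio_bounds n) as [_ Hp]; [lia|].
destruct (motzkin_ratio_bounds (S n)) as [Hc _]; [lia|].
destruct (motzkin_ratio_bounds (S (S n))) as [_ Hs]; [lia|].
replace (INR n + 2) with (INR (S n) + 2 - 1) in Hp by (rewrite S_INR; ring).
replace (INR (S (S n)) + 2) with (INR (S n) + 2 + 1) in Hs
  by (rewrite (S_INR (S n)); ring).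
apply Rle_ge.
eapply Rle_trans; [|eapply Rle_trans; [apply (ratio_bounds_log_concave _ Hw)|]].
- apply Rmult_le_compat; trivial; left; apply motzkin_ratio_pos.
- apply pow_incr; split; trivial.
  left; apply ratio_lower_pos; lra.
Qed.
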